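(* For every $n\in\mathbb N_0$ and $d\in\mathbb Z$, letting $T_0\in\{0,\dots,M\}$ with $T_0\equiv n\pmod{M+1}$, $$N(n,d;q)=q^{Mn}\sum_{s\in S(T_0,M+1,d)}\mu_{(M+1)n}(s).$$
   Context: Let $q$ be a prime power and $M\ge1$. A multisequence prefix is $a=(a_{k,m})_{1\le k\le n,\,1\le m\le M}\in(\mathbb F_q^M)^n$. Its linear complexity $L_a(n)$ is the least $L\ge0$ such that there exist $c_1,\dots,c_L\in\mathbb F_q$ with $a_{k,m}=\sum_{i=1}^L c_i a_{k-i,m}$ for all $L<k\le n$ and all $1\le m\le M$ (a single linear feedback shift register of length $L$ generating all $M$ sequences); $L_a(0)=0$. The linear complexity deviation is $d_a(n)=L_a(n)-\lceil nM/(M+1)\rceil$, and $N(n,d;q)$ is the number of $a\in(\mathbb F_q^M)^n$ with $d_a(n)=d$. The BDM: the augmented state set is $\overline S=\{(b_1,\dots,b_M,d;T,t): b_m,d,T\in\mathbb Z,\ 1\le t\le M+1,\ d+T+\sum_m b_m=0\}$, the state set is $S=\{s\in\overline S:0\le T\le M\}$, $S(T_0,t_0,d_0)=\{s\in S:T=T_0,t=t_0,d=d_0\}$, initial state $s_0=(0,\dots,0,0;0,M+1)$. Transitions from $s=(b_1,\dots,b_M,d;T,t)$: if $t\le M$ and $b_t>d$, with probability $(q-1)/q$ to $(b_1,\dots,b_{t-1},d,b_{t+1},\dots,b_M,b_t;T,t+1)$ and with probability $1/q$ to $(b_1,\dots,b_M,d;T,t+1)$; if $t\le M$ and $b_t\le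 d$, with probability 1 to $(b_1,\dots,b_M,d;T,t+1)$; if $t=M+1,T<M$, with probability 1 to $(b_1,\dots,b_M,d-1;T+1,1)$; if $t=M+1,T=M$, with probability 1 to $(b_1+1,\dots,b_M+1,d;0,1)$. Let $\mu_0$ be the point mass at $s_0$ and $\mu_{\tau+1}(s')=\sum_s\mu_\tau(s)p(s,s')$. *)

(* Defs.v *)
From HB Require Import structures.
From mathcomp Require Import all_boot all_order all_algebra.
Set Implicit Arguments. Unset Strict Implicit. Unset Printing Implicit Defensive.
Import Order.TTheory GRing.Theory Num.Theory.

Section LinComp.
Variables (F : finFieldType) (M n : nat).

(* A multisequence prefix a = (a_{k,m}), 1<=k<=n, 1<=m<=M, is stored 0-indexed:
   a k m with k : 'I_n, m : 'I_M. *)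
Definition mseq := {ffun 'I_n -> {ffun 'I_M -> F}}.

(* nat-indexed access (0 outside the range; only used inside the range) *)
Definition aget (a : mseq) (k : nat) (m : 'I_M) : F :=
  if (insub k : option 'I_n) is Some i then a i m else 0%R.

(* a single LFSR of length L with coefficients c_1..c_L (c i = c_{i+1})
   generates all M sequences: a_{k,m} = sum_{i=1}^L c_i a_{k-i,m} for L < k <= n *)
Definition lfsr_gen (a : mseq) (L : nat) : bool :=
  [exists c : {ffun 'I_L -> F},
    [forall k : 'I_n, (L <= k)%N ==>
       [forall m : 'I_M, a k m == (\sum_(i < L) c i * aget a (k - i.+1) m)%R]]].

Lemma lfsr_gen_ex (a : mseq) : exists L, lfsr_gen a L.
Proof.
exists n; apply/existsP; exists [ffun _ => 0%R]; apply/forallP => k.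
by rewrite leqNgt ltn_ord.
Qed.

Definition lin_comp (a : mseq) : nat := ex_minn (lfsr_gen_ex a).

Definition ceil_nM : nat := (n * M + M) %/ (M + 1).

Definition lc_dev (a : mseq) : int := ((lin_comp a)%:Z - ceil_nM%:Z)%R.

Definition Ncount (d : int) : nat := #|[set a : mseq | lc_dev a == d]|.

End LinComp.

Section BDM.
Variables (q M : nat).
Local Open Scope ring_scope.

(* augmented state (b_1..b_M, d; T, t) encoded as (b, d, T, t) with b : seq int *)
Definition state := (seq int * int * int * nat)%type.

Definition s0 : state := (nseq M 0, 0, 0, M.+1).

Definition step (s : state) : seq (state * rat) :=
  let: (b, d, T, t) := s in
  if (1 <= t <= M)%N then
    let bt := nth 0 b t.-1 in
    if d < bt then
      [:: ((set_nth 0 b t.-1 d, bt, T, t.+1), (q%:R - 1) / q%:R);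
          ((b, d, T, t.+1), 1 / q%:R)]
    else [:: ((b, d, T, t.+1), 1)]
  else if t == M.+1 then
    if T < M%:Z then [:: ((b, d - 1, T + 1, 1%N), 1)]
    else if T == M%:Z then [:: ((map (fun x => x + 1) b, d, 0, 1%N), 1)]
    else [::]
  else [::].

(* one step of the chain on a finitely supported measure, given as a list of
   weighted atoms: mu' (s') = sum_s mu(s) p(s,s') *)
Definition push (mu : seq (state * rat)) : seq (state * rat) :=
  flatten [seq [seq (x.1, w.2 * x.2) | x <- step w.1] | w <- mu].

Definition mu_list (tau : nat) : seq (state * rat) := iter tau push [:: (s0, 1)].

Definition mu (tau : nat) (s : state) : rat :=
  \sum_(w <- mu_list tau | w.1 == s) w.2.

(* the (finite) support of mu_tau: every state outside it has mu_tau(s) = 0 *)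
Definition mu_support (tau : nat) : seq state := undup [seq w.1 | w <- mu_list tau].

Definition in_Sbar (s : state) : bool :=
  let: (b, d, T, t) := s in
  [&& size b == M, (1 <= t <= M.+1)%N & d + T + \sum_(x <- b) x == 0].

Definition in_S (T0 : int) (t0 : nat) (d0 : int) (s : state) : bool :=
  let: (b, d, T, t) := s in
  [&& in_Sbar s, 0 <= T <= M%:Z, T == T0, t == t0 & d == d0].

End BDM.

(* Main.v *)
Require Import Defs.
From HB Require Import structures.
From mathcomp Require Import all_boot all_order all_algebra all_fingroup.
From mathcomp Require Import zify ring.
Import Order.TTheory GRing.Theory Num.Theory.
Local Open Scope ring_scope.

Set Implicit Arguments.
Unset Strict Implicit.
Unset Printing Implicit Defensive.

(* Let A_m be x^n times the generating series of the m-th sequence, truncated to n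
   terms.  A linear recurrence of length L for the prefix is a vector
   (C, R_1, ..., R_M) of the F[x]-lattice spanned by (1, A_1, ..., A_M) and the
   x^n e_m in which deg C = L exceeds every deg R_m.  Hence L_a(n) is the degree of
   the row leading at position 0 in a reduced (weak Popov) basis of the lattice.
   Starting a new column multiplies the positions 1..M by x, and reading the symbol
   a_{n,m} adds a multiple of column 0 to column m; if ties are broken suitably,
   only the rows 0 and m then have to be repaired.  Exactly one value of the symbol
   requires no repair; each of the q-1 others replaces the degrees D_0, D_m by
   max(D_0, D_m), min(D_0, D_m).  After a shift these are the transitions of the
   battery-discharge model, and summing over the symbols still to be read, by
   induction on the number of remaining transitions, gives the count. *)

(** * Reduced lattice bases and their minimality *)

(* Tie-breaking order 1, ..., t, 0, t+1, ..., M of the columns (smaller is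
   stronger): the positions already processed in the current round of M symbols
   beat position 0, the others lose to it. *)
Definition rk {M : nat} (t : nat) (j : 'I_M.+1) : nat :=
  if j == ord0 then (2 * t).+1 else (2 * j)%N.

Lemma rk_inj M t : injective (@rk M t).
Proof.
move=> i j; rewrite /rk -!val_eqE /= => H; apply/val_inj => /=.
by case: eqP H; case: eqP; lia.
Qed.

(* Row j has its leading entry at position j: entry i has degree at most D j, and
   strictly less if i beats j. *)
Definition reduced {F : fieldType} {M : nat} (t : nat) (D : 'I_M.+1 -> nat)
    (W : 'M[{poly F}]_M.+1) :=
  (forall j i, (size (W j i) <= D j + (rk t j <= rk t i))%N) /\
  (forall j, size (W j j) = (D j).+1).

Lemma reduced_id (F : fieldType) M t : reduced t (fun _ : 'I_M.+1 => 0%N) (1%:M : 'M[{poly F}]_M.+1).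
Proof.
split=> [j i|j]; rewrite !mxE ?eqxx ?size_poly1 //.
by case: eqP => [->|_]; rewrite ?leqnn ?size_poly1 // size_poly0.
Qed.

(* In a combination of the rows, the term of largest degree with the strongest
   leading position cannot be cancelled. *)
Lemma reduced_minimal (F : fieldType) M (D : 'I_M.+1 -> nat) (W : 'M[{poly F}]_M.+1)
    (u : 'rV[{poly F}]_M.+1) t :
  reduced t D W -> (u *m W) ord0 ord0 != 0 ->
  (forall i, i != ord0 -> size ((u *m W) ord0 i) < size ((u *m W) ord0 ord0))%N ->
  (D ord0 < size ((u *m W) ord0 ord0))%N.
Proof.
move=> [Wle Wd] nz lt_u.
have [u0|/rV0Pn[j0 nzj0]] := eqVneq u 0; first by rewrite u0 mul0mx mxE eqxx in nz.
(* [K] exceeds every rank, so maximizing [f] picks the largest [size (u j) + D j] and, among ties,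
   the strongest position. *)
pose K := (2 * (t + M)).+2.
have ltK (j : 'I_M.+1) : (rk t j < K)%N by rewrite /K /rk; have := ltn_ord j; case: ifP; lia.
clearbody K.
pose f (j : 'I_M.+1) := ((size (u ord0 j) + D j) * K + (K - rk t j))%N.
have [j nzj max_j] := @arg_maxnP _ j0 (fun j => u ord0 j != 0) f nzj0.
have {}max_j i : u ord0 i != 0 -> (f i <= f j)%N by apply: max_j.
(* The diagonal term wins at position [j]: a row tied with row [j] leads at a weaker position, so
   its entry at [j] is strictly below its degree. *)
have szj : size ((u *m W) ord0 j) = (size (u ord0 j) + D j)%N.
  have szd : size (u ord0 j * W j j) = (size (u ord0 j) + D j)%N.
    rewrite size_mul ?Wd ?addnS //.
    by rewrite -size_poly_eq0 Wd.
  rewrite mxE (bigD1 j) //= size_polyDl // szd.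
  apply: leq_ltn_trans (size_sum _ _ _) _.
  have pos : (0 < size (u ord0 j) + D j)%N by rewrite ltn_addr // size_poly_gt0.
  rewrite -(prednK pos) ltnS; apply/bigmax_leqP => i ij.
  have [->|nzi] := eqVneq (u ord0 i) 0; first by rewrite mul0r size_poly0.
  apply: leq_trans (size_polyMleq _ _) _.
  have := max_j i nzi; have := ltK i; have := ltK j; have := Wle i j.
  have : rk t i != rk t j by apply: contra ij => /eqP/rk_inj->.
  have : (0 < size (u ord0 i))%N by rewrite size_poly_gt0.
  rewrite /f; move: (rk t i) (rk t j) (size (u ord0 i)) (size (u ord0 j)) (size (W i j)) pos => a b si sj w.
  move=> pos si0 neq_ab le_w ltbK ltaK.
  case: (ltngtP (si + D i) (sj + D j)) => [lt_v _|lt_v max_v|eq_v max_v].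
  - by move: le_w; case: (leqP a b); lia.
  - by have := leq_mul lt_v (leqnn K); lia.
  - by rewrite eq_v in max_v; move: le_w; case: (leqP a b); lia.
have szle i : (size ((u *m W) ord0 i) <= size (u ord0 j) + D j)%N.
  rewrite mxE; apply: leq_trans (size_sum _ _ _) _; apply/bigmax_leqP => k _.
  have [->|nzk] := eqVneq (u ord0 k) 0; first by rewrite mul0r size_poly0.
  apply: leq_trans (size_polyMleq _ _) _.
  have := max_j k nzk; have := ltK k; have := ltK j; have := Wle k i.
  rewrite /f; move: (rk t k) (rk t j) (rk t i) (size (u ord0 k)) (size (u ord0 j)) (size (W k i)).
  move=> a b c si sj w le_w ltbK ltaK max_v; case: (ltnP (sj + D j) (si + D k)) => [lt_v|].
    by have := leq_mul lt_v (leqnn K); lia.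
  by move: le_w; case: (leqP a c); lia.
have j0E : j = ord0.
  by apply/eqP; apply: contraT => /lt_u; rewrite szj ltnNge szle.
by move: szj nzj; rewrite j0E -size_poly_gt0 => -> pos; rewrite -[X in (X < _)%N]add0n ltn_add2r.
Qed.

(** * Effect of a new column and of a new symbol on a basis *)

(** Position 0 loses every tie for [t = M] and wins them all for [t = 0]. Multiplying columns 1 to M
    by X makes the strict bounds of row 0 weak, while in the other rows the weak bound at position 0
    becomes strict as [D j] grows. *)
Lemma reduced_scale (F : fieldType) M (D : 'I_M.+1 -> nat) (W W' : 'M[{poly F}]_M.+1) :
  reduced M D W -> (forall j i, W' j i = W j i * (if i == ord0 then 1 else 'X)) ->
  reduced 0 (fun j => D j + (j != ord0))%N W'.
Proof.
move=> [Wle Wd] W'E; split=> [j i|j].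
  have := Wle j i; rewrite W'E /rk; have := ltn_ord j; have := ltn_ord i.
  have [i0|ni] := eqVneq i ord0; have [j0|nj] := eqVneq j ord0; rewrite ?mulr1 //.
  - by rewrite !leqnn addn0.
  - by move=> _ _ /leq_trans; apply; rewrite -addnA leq_add2l; case: (2 * j <= _)%N.
  - move=> ltiM _ le; apply: leq_trans (size_polyMleq _ _) _; rewrite size_polyX addn2 /=.
    move: ni le; rewrite -val_eqE /=; move: (size _) => z.
    by case: (leqP (2 * M).+1 (2 * i)); case: (leqP (2 * 0).+1 (2 * i)); lia.
  - move=> _ _ le; apply: leq_trans (size_polyMleq _ _) _; rewrite size_polyX addn2 /=.
    by move: le; move: (size _) => z; case: (leqP (2 * j) (2 * i)); lia.
rewrite W'E; case: eqP => [->|_]; rewrite ?mulr1 ?addn0 // size_mulX ?Wd ?addn1 //.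
by rewrite -size_poly_eq0 Wd.
Qed.

(** From [t] to [t.+1] only the neighbours 0 and [m] trade places in the order. *)
Lemma rkS M t (m j i : 'I_M.+1) : m = t.+1 :> nat ->
  ~~ ((j == ord0) && (i == m)) -> ~~ ((j == m) && (i == ord0)) ->
  (rk t.+1 j <= rk t.+1 i)%N = (rk t j <= rk t i)%N.
Proof.
rewrite /rk -!val_eqE /= => ->; move: (val j) (val i) => a b.
by case: (eqVneq a 0%N) => [->|]; case: (eqVneq b 0%N) => [->|] //=;
  rewrite ?leqnn //; case: eqP => //; lia.
Qed.

(** As neighbours, 0 and [m] compare alike with any third position, so bounds carry over between
    rows 0 and [m]. *)
Lemma rk_adj M t (m i : 'I_M.+1) : m = t.+1 :> nat -> i != ord0 -> i != m ->
  (rk t.+1 m <= rk t.+1 i)%N = (rk t.+1 (ord0 : 'I_M.+1) <= rk t.+1 i)%N.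
Proof.
rewrite /rk -!val_eqE /= => ->; move: (val i) => b.
by case: (eqVneq b 0%N) => //=; lia.
Qed.

Lemma size_cancel (F : fieldType) (P Q : {poly F}) a b :
  size P = a.+1 -> size Q = b.+1 -> (b <= a)%N ->
  (size (P - (lead_coef P / lead_coef Q) *: ('X^(a - b) * Q))%R <= a)%N.
Proof.
move=> szP szQ le_ba; apply/leq_sizeP => j le_aj.
have nzQ : lead_coef Q != 0 by rewrite lead_coef_eq0 -size_poly_eq0 szQ.
rewrite coefB coefZ coefXnM ltnNge (leq_trans (leq_subr _ _) le_aj) /=.
move: le_aj; rewrite leq_eqVlt => /orP[/eqP <-|lt_aj].
  by move: nzQ; rewrite subKn // !lead_coefE szP szQ => nzQ; rewrite divfK // subrr.
by rewrite !nth_default ?mulr0 ?subr0 ?szP ?szQ //; lia.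
Qed.

Lemma size_shift (F : fieldType) (c : F) (Q : {poly F}) k :
  (size (c *: ('X^k * Q)) <= k + size Q)%N.
Proof.
apply: leq_trans (size_scale_leq _ _) _; apply: leq_trans (size_polyMleq _ _) _.
by rewrite size_polyXn.
Qed.

Lemma size_shift_eq (F : fieldType) (c : F) (Q : {poly F}) k :
  c != 0 -> Q != 0 -> size (c *: ('X^k * Q)) = (k + size Q)%N.
Proof.
move=> nzc nzQ; have nzX : 'X^k != 0 :> {poly F} by rewrite monic_neq0 ?monicXn.
by rewrite size_scale // size_mul // size_polyXn.
Qed.

Definition addrow {F : fieldType} {M} (m : 'I_M.+1) (c : {poly F}) : 'M[{poly F}]_M.+1 :=
  1%:M - c *: delta_mx ord0 m.

Lemma addrow_unit (F : fieldType) M (m : 'I_M.+1) (c : {poly F}) :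
  m != ord0 -> addrow m c \in unitmx.
Proof.
move=> nm; suff /mulmx1_unit[] : addrow m c *m addrow m (- c) = 1%:M by [].
rewrite /addrow scaleNr opprK mulmxBl mul1mx mulmxDr mulmx1 -scalemxAl -scalemxAr.
by rewrite mul_delta_mx_0 // !scaler0 addr0 addrK.
Qed.

Lemma addrowE (F : fieldType) M (m : 'I_M.+1) (c : {poly F}) (W : 'M_M.+1) j i :
  (addrow m c *m W) j i = W j i - (if j == ord0 then c * W m i else 0).
Proof.
rewrite /addrow mulmxBl mul1mx -scalemxAl !mxE (bigD1 m) //= big1 ?addr0 => [|k nkm].
  by rewrite mxE eqxx andbT; case: eqP; rewrite ?mul1r ?mul0r ?mulr0.
by rewrite mxE (negPf nkm) andbF mul0r.
Qed.

(* Only the value x0 of the new symbol gives discrepancy 0.  Otherwise rows 0 and m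
   both lead at position m, and the one of larger degree, reduced by the other,
   becomes the new row 0. *)
Lemma reduced_symbol (F : fieldType) M t (m : 'I_M.+1) D (W : 'M[{poly F}]_M.+1) :
  m = t.+1 :> nat -> reduced t D W ->
  exists x0 : F, forall (x : F) (W' : 'M_M.+1),
  (forall j i, W' j i = W j i + (if i == m then x *: W j ord0 else 0)) ->
  exists2 E, E \in unitmx &
    reduced t.+1 (if (x != x0) && (D ord0 < D m)%N then D \o tperm ord0 m else D) (E *m W').
Proof.
move=> mE [Wle Wd].
have nm0 : m != ord0 by rewrite -val_eqE /= mE.
have n0m : ord0 != m by rewrite eq_sym.
have rk0m : (rk t m <= rk t (ord0 : 'I_M.+1))%N = false.
  by rewrite /rk (negPf nm0) eqxx mE; lia.
have rk0m' : (rk t.+1 (ord0 : 'I_M.+1) <= rk t.+1 m)%N = false.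
  by rewrite /rk (negPf nm0) eqxx mE; lia.
have rkm0' : (rk t.+1 m <= rk t.+1 (ord0 : 'I_M.+1))%N.
  by rewrite /rk (negPf nm0) eqxx mE; lia.
have Wm0 : (size (W m ord0) <= D m)%N by have := Wle m ord0; rewrite rk0m addn0.
set l := (W ord0 ord0)`_(D ord0).
have nzl : l != 0.
  have : lead_coef (W ord0 ord0) != 0 by rewrite lead_coef_eq0 -size_poly_eq0 Wd.
  by rewrite lead_coefE Wd.
(* The new entry of row 0 at position [m] has in degree [D ord0] a constant plus [x * l]; this is
   the only zero. *)
exists (- (W ord0 m)`_(D ord0) / l) => x W' W'E.
have W'0 j : W' j ord0 = W j ord0 by rewrite W'E (negPf n0m) addr0.
have W'ne j i : i != m -> W' j i = W j i by move=> /negPf nim; rewrite W'E nim addr0.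
have W'd j : j != ord0 -> size (W' j j) = (D j).+1.
  move=> nj; have [->|njm] := eqVneq j m; last by rewrite W'ne.
  rewrite W'E eqxx size_polyDl ?Wd // ltnS.
  exact: leq_trans (size_scale_leq _ _) Wm0.
have W'le j i : j != ord0 -> (size (W' j i) <= D j + (rk t.+1 j <= rk t.+1 i))%N.
  move=> nj; have [->|njm] := eqVneq j m.
    have [->|ni0] := eqVneq i ord0; first by rewrite W'0 (leq_trans Wm0) // leq_addr.
    have [->|nim] := eqVneq i m; first by rewrite W'd // leqnn addn1.
    by rewrite (rkS mE) ?eqxx ?(negPf ni0) ?(negPf nm0) ?andbF // W'ne.
  rewrite (rkS mE) ?(negPf nj) ?(negPf njm) //.
  have [eim|nim] := eqVneq i m; last by rewrite W'ne.
  rewrite W'E eim eqxx; apply: leq_trans (size_polyD _ _) _; rewrite geq_max Wle.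
  apply: leq_trans (size_scale_leq _ _) _; apply: leq_trans (Wle _ _) _.
  rewrite leq_add2l /rk (negPf nj) (negPf nm0) eqxx mE.
  by case: (leqP (2 * j) (2 * t).+1); case: (leqP (2 * j) (2 * t.+1)); lia.
have W'0le i : i != m -> (size (W' ord0 i) <= D ord0 + (rk t.+1 (ord0 : 'I_M.+1) <= rk t.+1 i))%N.
  by move=> nim; rewrite W'ne // (rkS mE) ?(negPf nim) ?(negPf n0m) ?andbF.
have W'00 : size (W' ord0 ord0) = (D ord0).+1 by rewrite W'0.
have W'0m : (size (W' ord0 m) <= (D ord0).+1)%N.
  rewrite W'E eqxx; apply: leq_trans (size_polyD _ _) _; rewrite geq_max.
  rewrite (leq_trans (size_scale_leq _ _)) ?Wd // andbT.
  by apply: leq_trans (Wle _ _) _; rewrite -[X in (_ <= X)%N]addn1 leq_add2l leq_b1.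
have coef0m : (W' ord0 m)`_(D ord0) = (W ord0 m)`_(D ord0) + x * l.
  by rewrite W'E eqxx coefD coefZ.
have [xE /=|nx /=] := eqVneq x _.
  exists 1%:M; rewrite ?unitmx1 // mul1mx; split=> [j i|j]; last first.
    by have [->|nj] := eqVneq j ord0; [exact: W'00 | exact: W'd].
  have [->|nj] := eqVneq j ord0; last exact: W'le.
  have [->|nim] := eqVneq i m; last exact: W'0le.
  rewrite rk0m' addn0; apply/leq_sizeP => k; rewrite leq_eqVlt => /orP[/eqP <-|lt_k].
    by rewrite coef0m xE divfK // addrN.
  by rewrite nth_default // (leq_trans W'0m).
have W'0md : size (W' ord0 m) = (D ord0).+1.
  apply/eqP; rewrite eqn_leq W'0m /= ltnNge; apply: contra nx => /leq_sizeP/(_ _ (leqnn _)).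
  by rewrite coef0m => /eqP; rewrite addrC addr_eq0 => /eqP <-; rewrite mulfK.
case: ltnP => [lt_D|le_D].
  (* Row [m] has the larger degree: after a swap, the new row 0 is the old row [m] minus a multiple
     of the old row 0. *)
  pose c := (lead_coef (W' m m) / lead_coef (W' ord0 m)) *: 'X^(D m - D ord0).
  have cne0 : lead_coef (W' m m) / lead_coef (W' ord0 m) != 0.
    by rewrite mulf_neq0 ?invr_eq0 // lead_coef_eq0 -size_poly_eq0 ?W'0md ?W'd.
  exists (addrow m c *m tperm_mx ord0 m).
    by rewrite unitmx_mul addrow_unit //= unitmx_perm.
  have E j i : (addrow m c *m tperm_mx ord0 m *m W') j i =
      if j == ord0 then W' m i - c * W' ord0 i else W' (tperm ord0 m j) i.
    rewrite -mulmxA addrowE -xrowE !mxE tpermR.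
    by case: eqP => [->|_]; rewrite ?tpermL ?subr0.
  split=> [j i|j]; rewrite E /=.
    have [->|nj] := eqVneq j ord0; rewrite ?tpermL.
      have [->|nim] := eqVneq i m.
        by rewrite rk0m' addn0 /c -scalerAl size_cancel ?W'd // ltnW.
      apply: leq_trans (size_polyD _ _) _; rewrite geq_max size_polyN -scalerAl.
      have [->|ni0] := eqVneq i ord0.
        rewrite leqnn addn1 W'0 (leq_trans Wm0) //=.
        by apply: leq_trans (size_shift _ _ _) _; rewrite W'00 addnS subnK // ltnW.
      rewrite -(rk_adj mE) // W'le //=; apply: leq_trans (size_shift _ _ _) _.
      by rewrite (rk_adj mE) //; have := W'0le i nim; move: (size _) (nat_of_bool _) => a b; lia.
    have [->|njm] := eqVneq j m; last by rewrite tpermD 1?eq_sym // W'le.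
    rewrite tpermR; have [->|nim] := eqVneq i m; first by rewrite W'0md leqnn addn1.
    have [->|ni0] := eqVneq i ord0; first by rewrite rkm0' W'00 addn1.
    by rewrite (rk_adj mE) // W'0le.
  have [->|nj] := eqVneq j ord0.
    have szc : size (- (c * W' ord0 ord0)) = (D m).+1.
      rewrite size_polyN /c -scalerAl size_shift_eq //; last by rewrite -size_poly_eq0 W'00.
      by rewrite W'00 addnS subnK // ltnW.
    by rewrite tpermL addrC size_polyDl szc // W'0 ltnS.
  have [->|njm] := eqVneq j m; first by rewrite tpermR.
  by rewrite tpermD 1?eq_sym // W'd.
pose c := (lead_coef (W' ord0 m) / lead_coef (W' m m)) *: 'X^(D ord0 - D m).
exists (addrow m c); first exact: addrow_unit.
split=> [j i|j]; rewrite addrowE.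
  have [->|nj] := eqVneq j ord0; last by rewrite subr0 W'le.
  have [->|nim] := eqVneq i m; first by rewrite rk0m' addn0 /c -scalerAl size_cancel ?W'd.
  apply: leq_trans (size_polyD _ _) _; rewrite geq_max size_polyN W'0le //= /c -scalerAl.
  apply: leq_trans (size_shift _ _ _) _.
  have [->|ni0] := eqVneq i ord0; first by rewrite W'0; lia.
  by rewrite -(rk_adj mE) //; have := W'le m i nm0; move: (size _) (nat_of_bool _) => a b; lia.
have [->|nj] := eqVneq j ord0; last by rewrite subr0 W'd.
rewrite size_polyDl W'00 // size_polyN /c -scalerAl.
by apply: leq_ltn_trans (size_shift _ _ _) _; rewrite W'0; lia.
Qed.

(** * The lattice of a prefix and its linear complexity *)

Definition mseq_of (F : finFieldType) (M n : nat) (p : seq F) : mseq F M n :=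
  [ffun k : 'I_n => [ffun m : 'I_M => nth 0 p (k * M + m)%N]].

(* x^n times the generating series of the m-th sequence, truncated to n terms. *)
Definition revpoly {F : fieldType} (M n : nat) (p : seq F) (m : nat) : {poly F} :=
  \poly_(u < n) nth 0 p ((n - u.+1) * M + m)%N.

(** [C] is a multiple of the characteristic polynomial of the register. As [revpoly] reverses time,
    the coefficient of the product at [s] is the recurrence at index n - 1 - s + l. *)
Lemma lfsr_genP (F : finFieldType) M n (p : seq F) l :
  reflect (exists2 C : {poly F}, size C = l.+1 &
            forall (m : 'I_M) s, (l <= s < n)%N -> (C * revpoly M n p m)`_s = 0)
          (lfsr_gen (mseq_of M n p) l).
Proof.
have agetE (m : 'I_M) k : (k < n)%N -> aget (mseq_of M n p) k m = nth 0 p (k * M + m)%N.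
  by move=> lt_kn; rewrite /aget insubT !ffunE.
have coefE (C : {poly F}) (m : 'I_M) s : size C = l.+1 -> (l <= s < n)%N ->
    (C * revpoly M n p m)`_s = \sum_(i < l.+1) C`_i * nth 0 p ((n - (s - i).+1) * M + m)%N.
  move=> szC /andP[le_ls lt_sn].
  rewrite coefM (big_ord_widen s.+1 (fun i => C`_i * nth 0 p ((n - (s - i).+1) * M + m)%N)) //.
  rewrite [RHS]big_mkcond /=; apply: eq_bigr => i _; rewrite coef_poly.
  rewrite (leq_ltn_trans (leq_subr _ _) lt_sn); case: ltnP => // le_li.
  by rewrite nth_default ?mul0r // szC.
apply: (iffP existsP) => [[c /forallP cP]|[C szC CP]].
  pose C : {poly F} := 'X^l - \poly_(i < l) oapp c 0 (insub (l - i.+1)%N).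
  have szC : size C = l.+1.
    by rewrite /C size_polyDl ?size_polyXn // size_polyN ltnS size_poly.
  exists C => // m s sP; rewrite coefE //; case/andP: sP => le_ls lt_sn.
  have lt_k : (n - s.+1 + l < n)%N by lia.
  have := cP (Ordinal lt_k); rewrite /= leq_addl /= => /forallP/(_ m)/eqP.
  rewrite /mseq_of !ffunE /= => eq_k.
  rewrite big_ord_recr /= {2}/C coefB coefXn eqxx coef_poly ltnn subr0 mul1r.
  rewrite [X in nth 0 p X](_ : _ = ((n - s.+1 + l) * M + m)%N); last by congr (_ * M + _)%N; lia.
  rewrite eq_k (reindex_inj rev_ord_inj) -big_split big1 //= => i _.
  rewrite /C coefB coefXn coef_poly.
  have -> : (l - i.+1 == l)%N = false by have := ltn_ord i; lia.
  have -> : (l - i.+1 < l)%N by have := ltn_ord i; lia.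
  have -> : (l - (l - i.+1).+1)%N = i by have := ltn_ord i; lia.
  rewrite valK /= sub0r mulNr agetE; last by lia.
  rewrite addrC; apply/eqP; rewrite subr_eq0; apply/eqP.
  by congr (_ * nth 0 p (_ * M + _)%N); have := ltn_ord i; lia.
have nzC : C`_l != 0.
  have : lead_coef C != 0 by rewrite lead_coef_eq0 -size_poly_eq0 szC.
  by rewrite lead_coefE szC.
exists [ffun i : 'I_l => - C`_(l - i.+1) / C`_l].
apply/forallP => k; apply/implyP => le_lk; apply/forallP => m; apply/eqP.
have sP : (l <= n - k.+1 + l < n)%N by have := ltn_ord k; lia.
have := CP m _ sP; rewrite coefE // big_ord_recr /= (reindex_inj rev_ord_inj) /=.
rewrite [X in nth 0 p X](_ : _ = (k * M + m)%N); last by congr (_ * M + _)%N; have := ltn_ord k; lia.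
move/eqP; rewrite addrC addr_eq0 => /eqP eq_k; apply: (mulfI nzC).
rewrite !ffunE eq_k mulr_sumr -sumrN; apply: eq_bigr => i _.
rewrite ffunE mulrA [C`_l * _]mulrC divfK // mulNr agetE; last by have := ltn_ord k; lia.
by congr (- (_ * nth 0 p (_ * M + _)%N)); have := ltn_ord k; have := ltn_ord i; lia.
Qed.

(* Maps (C, P_1, ..., P_M) to (C, C A_1 + x^n P_1, ..., C A_M + x^n P_M). *)
Definition latmx (F : fieldType) (M n : nat) (p : seq F) : 'M[{poly F}]_M.+1 :=
  \matrix_(i, j) if i == ord0 then if j == ord0 then 1 else revpoly M n p j.-1
                 else (i == j)%:R * 'X^n.

Lemma mul_latmx0 (F : fieldType) M n (p : seq F) k (V : 'M_(k, M.+1)) j :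
  (V *m latmx M n p) j ord0 = V j ord0.
Proof.
rewrite mxE big_ord_recl big1 ?addr0 => [|i _]; first by rewrite mxE !eqxx mulr1.
by rewrite mxE /= mul0r mulr0.
Qed.

Lemma mul_latmxE (F : fieldType) M n (p : seq F) k (V : 'M_(k, M.+1)) j i : i != ord0 ->
  (V *m latmx M n p) j i = V j ord0 * revpoly M n p i.-1 + V j i * 'X^n.
Proof.
move=> ni; rewrite mxE (bigD1 ord0) //= (bigD1 i) //= big1 ?addr0 => [|l /andP[nl nli]].
  by rewrite !mxE eqxx (negPf ni) eqxx mul1r.
by rewrite mxE (negPf nl) (negPf nli) mul0r mulr0.
Qed.

(** Row 0 gives a recurrence of length [D ord0], since for [t = M] its other entries have smaller
    degree. Conversely, a shortest recurrence is a lattice vector led by position 0, and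
    [reduced_minimal] applies. *)
Lemma lin_comp_reduced (F : finFieldType) M n (p : seq F) D (V : 'M_M.+1) :
  V \in unitmx -> reduced M D (V *m latmx M n p) ->
  lin_comp (mseq_of M n p) = D ord0.
Proof.
move=> uV red; have [Wle Wd] := red.
have upper : lfsr_gen (mseq_of M n p) (D ord0).
  apply/lfsr_genP; exists (V ord0 ord0); first by rewrite -(mul_latmx0 n p) Wd.
  move=> m s /andP[le_Ds lt_sn].
  have := Wle ord0 (lift ord0 m); rewrite mul_latmxE // /= => le_D.
  have /leq_sizeP/(_ s le_Ds) : (size (V ord0 ord0 * revpoly M n p m
     + V ord0 (lift ord0 m) * 'X^n)%R <= D ord0)%N.
    apply: leq_trans le_D _; rewrite /rk /= /bump /=; have := ltn_ord m.
    by case: leqP; lia.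
  by rewrite coefD coefMXn lt_sn addr0.
rewrite /lin_comp; case: ex_minnP => l /lfsr_genP[C szC CP] minl.
apply/eqP; rewrite eqn_leq minl //=.
(* This leaves the remainder of C A_m modulo x^n, whose coefficients from [l] on vanish. *)
pose u : 'rV[{poly F}]_M.+1 :=
  \row_j if j == ord0 then C else - drop_poly n (C * revpoly M n p j.-1).
have uE : u *m latmx M n p = (u *m invmx V) *m (V *m latmx M n p).
  by rewrite mulmxA mulmxKV.
have u0 : (u *m latmx M n p) ord0 ord0 = C by rewrite mul_latmx0 mxE eqxx.
have := reduced_minimal (u := u *m invmx V) red; rewrite -uE u0 szC ltnS; apply.
  by rewrite -size_poly_eq0 szC.
move=> i ni; rewrite mul_latmxE // !mxE eqxx (negPf ni) mulNr.
set P := C * _; rewrite -{1}(poly_take_drop n P) addrK ltnS.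
apply/leq_sizeP => s le_ls; rewrite coef_take_poly; case: ltnP => // lt_sn.
have [m mE] : exists m : 'I_M, i = lift ord0 m.
  by case: (unliftP ord0 i) ni => [m ->|->]; rewrite ?eqxx //; exists m.
by rewrite /P mE /= CP // le_ls.
Qed.

(** A freshly started column reads as zeros, so each A_m is just multiplied by X. *)
Lemma mulmx_latmxS (F : fieldType) M N (p : seq F) (V : 'M[{poly F}]_M.+1) (j i : 'I_M.+1) :
  (size p <= N * M)%N ->
  (V *m latmx M N.+1 p) j i = (V *m latmx M N p) j i * (if i == ord0 then 1 else 'X).
Proof.
move=> szp; have [->|ni] := eqVneq i ord0; first by rewrite !mul_latmx0 mulr1.
rewrite !mul_latmxE // mulrDl -!mulrA -exprSr; congr (_ * _ + _).
apply/polyP => -[|u]; rewrite coefMX /= !coef_poly /=.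
  by rewrite subn1 /= nth_default // (leq_trans szp) // leq_addr.
by rewrite ltnS subSS.
Qed.

(** The symbol just read is the constant coefficient of A_(t+1); all higher coefficients come from
    completed columns. *)
Lemma mulmx_latmx_rcons (F : fieldType) M N t (p : seq F) (x : F) (V : 'M[{poly F}]_M.+1) (j i : 'I_M.+1) :
  (t < M)%N -> size p = (N * M + t)%N ->
  (V *m latmx M N.+1 (rcons p x)) j i = (V *m latmx M N.+1 p) j i +
    (if i == inord t.+1 then x *: (V *m latmx M N.+1 p) j ord0 else 0).
Proof.
move=> lt_tM szp; have mE : (inord t.+1 : 'I_M.+1) = t.+1 :> nat by rewrite inordK.
have [->|ni] := eqVneq i ord0.
  by rewrite !mul_latmx0 -val_eqE /= mE addr0.
rewrite mul_latmx0 !mul_latmxE // addrAC; congr (_ + _).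
have [m iE] : exists m : 'I_M, i = lift ord0 m.
  by case: (unliftP ord0 i) ni => [m ->|->]; rewrite ?eqxx //; exists m.
have im : (i == inord t.+1) = (m == t :> nat) by rewrite iE -val_eqE /= mE eqSS.
suff -> : revpoly M N.+1 (rcons p x) i.-1 =
    revpoly M N.+1 p i.-1 + (if m == t :> nat then x%:P else 0).
  by rewrite im mulrDr; case: eqP; rewrite ?mulr0 // -mul_polyC [x%:P * _]mulrC.
rewrite iE /=; apply/polyP => u; rewrite coefD !coef_poly (fun_if (fun q : {poly F} => q`_u)).
rewrite coefC coef0; have ltm := ltn_ord m.
case: ltnP => [lt_u|le_u]; last first.
  by case: u le_u => //= u _; rewrite if_same addr0.
rewrite subSS nth_rcons szp.
case: u lt_u => [|u] lt_u /=.
  rewrite subn0 ltn_add2l eqn_add2l; case: ltngtP => [lt_mt|lt_tm|->] //; rewrite ?addr0 //.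
  - by rewrite nth_default // szp leq_add2l ltnW.
  - by rewrite nth_default ?add0r // szp.
rewrite if_same addr0.
have lt_k : ((N - u.+1) * M + m < N * M)%N.
  have lt_N : (N - u.+1 < N)%N by lia.
  by have := leq_mul lt_N (leqnn M); lia.
by rewrite (ltn_addr _ lt_k).
Qed.

(** * Degrees as states of the battery-discharge model *)

Lemma ceil_nME M N : ceil_nM M N = (N %/ M.+1 * M + N %% M.+1)%N.
Proof.
rewrite /ceil_nM addn1 {1}(divn_eq N M.+1).
have := ltn_pmod N (ltn0Sn M); move: (N %/ _)%N (N %% _)%N => k r lt_r.
rewrite (_ : _ + M = (k * M + r) * M.+1 + (M - r))%N; last by nia.
by rewrite divnMDl // divn_small ?addn0 // ltnS leq_subr.
Qed.

(* With N columns started and t symbols of the last one read, b_m and d are the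
   degrees of the rows m and 0, shifted by the expected complexity of N columns. *)
Definition bdm_state M (N t : nat) (D : 'I_M.+1 -> nat) : state :=
  (mkseq (fun i => (D (inord i.+1))%:Z - (ceil_nM M N)%:Z) M,
   (D ord0)%:Z - (ceil_nM M N)%:Z, (N %% M.+1)%:Z, t.+1).

(** The ceiling grows by 1 with [N], except that it stays when N is M modulo M+1. As D_1, ..., D_M
    rise by 1, either only d drops or all b_m rise. *)
Lemma step_column q M N (D : 'I_M.+1 -> nat) :
  step q M (bdm_state N M D) =
    [:: (bdm_state N.+1 0 (fun j => D j + (j != ord0))%N, 1)].
Proof.
rewrite /step /bdm_state /= ltnn eqxx.
have lt_r := ltn_pmod N (ltn0Sn M).
have bS : mkseq (fun i => (D (inord i.+1) + ((inord i.+1 : 'I_M.+1) != ord0))%N%:Z - (ceil_nM M N.+1)%:Z) M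
   = mkseq (fun i => (D (inord i.+1))%:Z + 1 - (ceil_nM M N.+1)%:Z) M.
  apply/eq_in_map => i; rewrite mem_iota /= => lt_i.
  by rewrite -val_eqE /= inordK // PoszD.
rewrite bS /= addn0 !ceil_nME.
have [ltT|geT] := ltnP (N %% M.+1) M.
  have eN : N.+1 = (N %/ M.+1 * M.+1 + (N %% M.+1).+1)%N by rewrite addnS -divn_eq.
  have -> : (N.+1 %/ M.+1)%N = (N %/ M.+1)%N by rewrite {1}eN divnMDl // (@divn_small (_ %% _).+1) ?addn0 ?ltnS.
  have -> : (N.+1 %% M.+1)%N = (N %% M.+1).+1 by rewrite {1}eN modnMDl modn_small ?ltnS.
  rewrite ltz_nat ltT; congr [:: (_, _, _, _, _)]; try lia.
  by apply/eq_map => i; lia.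
have eT : (N %% M.+1)%N = M by lia.
have eN : N.+1 = ((N %/ M.+1).+1 * M.+1)%N by rewrite mulSn addnC {1}(divn_eq N M.+1) eT addnS.
have -> : (N.+1 %/ M.+1)%N = (N %/ M.+1).+1 by rewrite {1}eN mulnK.
have -> : (N.+1 %% M.+1)%N = 0%N by rewrite {1}eN modnMl.
rewrite eT ltxx eqxx; congr [:: (_, _, _, _, _)]; try lia.
by rewrite -map_comp; apply/eq_map => i /=; lia.
Qed.

Lemma step_symbol q M N t (D : 'I_M.+1 -> nat) (m := inord t.+1 : 'I_M.+1) : (t < M)%N ->
  step q M (bdm_state N t D) =
    if (D ord0 < D m)%N then
      [:: (bdm_state N t.+1 (D \o tperm ord0 m), (q%:R - 1) / q%:R);
          (bdm_state N t.+1 D, 1 / q%:R)]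
    else [:: (bdm_state N t.+1 D, 1)].
Proof.
move=> lt_tM; rewrite /step {1}/bdm_state /= lt_tM nth_mkseq // ltrD2r ltz_nat -/m.
case: ifP => // _; congr [:: (_, _, _, _, _); _]; last by rewrite /= tpermL.
apply: (@eq_from_nth _ 0) => [|i]; rewrite size_set_nth !size_mkseq; first exact/maxn_idPr.
rewrite (maxn_idPr _) // => lt_i; rewrite nth_set_nth /= !nth_mkseq //.
have [->|ni] := eqVneq i t; first by rewrite -/m tpermR.
by rewrite tpermD // -val_eqE /= ?inordK // eq_sym eqSS.
Qed.

(** * Expectations along the chain *)

(** Expected value of [g] one step after [s]; this operator is dual to [push]. *)
Definition bdm_pullback q M (g : state -> rat) (s : state) : rat :=
  \sum_(x <- step q M s) x.2 * g x.1.

Lemma sum_iter_push q M g tau l :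
  \sum_(w <- iter tau (push q M) l) w.2 * g w.1 =
  \sum_(w <- l) w.2 * iter tau (bdm_pullback q M) g w.1.
Proof.
elim: tau g => //= tau IH g.
rewrite {1}/push big_flatten big_map.
under eq_bigr => w _.
  rewrite big_map; under eq_bigr => x _ do rewrite -mulrA.
  rewrite -mulr_sumr -/(bdm_pullback q M g w.1).
  over.
by rewrite IH -iterSr iterS.
Qed.

Lemma sum_mu_support q M tau (P : pred state) :
  \sum_(s <- mu_support q M tau | P s) mu q M tau s =
  iter tau (bdm_pullback q M) (fun s => (P s)%:R) (s0 M).
Proof.
have := sum_iter_push q M (fun s => (P s)%:R) tau [:: (s0 M, 1)].
rewrite big_seq1 mul1r => <-; rewrite -/(mu_list q M tau) /mu.
(* Each atom meets its state once in the duplicate-free support. *)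
rewrite (exchange_big_dep xpredT) //= [RHS]big_seq [LHS]big_seq; apply: eq_bigr => w w_in.
rewrite (eq_bigl (fun s => (s == w.1) && P s)); last by move=> s; rewrite andbC eq_sym.
rewrite big_mkcondr big_mkcond (bigD1_seq w.1) ?undup_uniq ?mem_undup ?map_f //=.
rewrite eqxx big1 ?addr0 => [|s /negPf-> //].
by case: ifP; rewrite ?mulr1 ?mulr0.
Qed.

(** * Sums over words and the induction along the chain *)

Fixpoint wsum (F : finType) (R : nmodType) r (f : seq F -> R) : R :=
  if r is r'.+1 then \sum_(x : F) wsum r' (fun s => f (x :: s)) else f [::].

Lemma wsumE (F : finType) (R : nmodType) r (f : seq F -> R) :
  wsum r f = \sum_(s : r.-tuple F) f s.
Proof.
elim: r f => [|r IH] f /=.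
  rewrite (big_pred1 [tuple]) // => s.
  by apply/esym/eqP/tuple0.
under eq_bigr => x _ do rewrite IH.
rewrite pair_big (reindex (fun s : r.+1.-tuple F => (thead s, behead_tuple s))) /=.
  by apply: eq_bigr => s _; rewrite [in RHS](tuple_eta s).
exists (fun xs : F * r.-tuple F => [tuple of xs.1 :: xs.2]) => [s _|[x s] _] /=.
  by apply/val_inj; rewrite [in RHS](tuple_eta s).
by congr (_, _); apply/val_inj.
Qed.

Lemma eq_wsum (F : finType) (R : nmodType) r (f g : seq F -> R) :
  f =1 g -> wsum r f = wsum r g.
Proof.
by elim: r f g => [|r IH] f g fg /=; [exact: fg | apply: eq_bigr => x _; apply: IH].
Qed.

(** Uniform symbols reproduce the transition probabilities (q-1)/q and 1/q, up to the factor q. *)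
Lemma sum_but_one (F : finType) (x0 : F) (b : bool) (u v : rat) :
  \sum_(x : F) (if (x != x0) && b then u else v) =
  #|F|%:R * (if b then (#|F|%:R - 1) / #|F|%:R * u + 1 / #|F|%:R * v else v).
Proof.
have q_gt0 : (0 < #|F|)%N by apply/card_gt0P; exists x0.
have q_neq0 : #|F|%:R != 0 :> rat by rewrite pnatr_eq0 -lt0n.
case: b; last first.
  by under eq_bigr do rewrite andbF; rewrite sumr_const mulr_natl.
rewrite (bigD1 x0) //= eqxx /= (eq_bigr (fun=> u)) => [|x /negPf-> //].
rewrite sumr_const cardC1 -subn1 -[u *+ _]mulr_natl natrB //.
by field.
Qed.

(** With [c] columns still to start, [tau] counts [c] column steps and c M + (M - t) symbol steps;
    only the latter give a factor q. The equation for [size p] also covers the empty start [N = 0],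
    [t = M]. *)
Lemma wsum_bdm (F : finFieldType) M n (f : seq F -> rat) (g : state -> rat) :
  (forall p D (V : 'M_M.+1), size p = (n * M)%N -> V \in unitmx ->
    reduced M D (V *m latmx M n p) -> (\sum_j D j)%N = (n * M)%N ->
    f p = g (bdm_state n M D)) ->
  forall tau c N t p D (V : 'M_M.+1), n = (N + c)%N -> (t <= M)%N ->
  tau = (c * M.+1 + (M - t))%N -> (size p + M = N * M + t)%N ->
  V \in unitmx -> reduced t D (V *m latmx M N p) -> (\sum_j D j)%N = (N * M)%N ->
  wsum (c * M + (M - t)) (fun s => f (p ++ s)) =
    #|F|%:R ^+ (c * M + (M - t)) *
    iter tau (bdm_pullback #|F| M) g (bdm_state N t D).
Proof.
move=> fg; elim=> [|tau IH] c N t p D V nE le_tM tauE szp uV red sumD.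
  have c0 : c = 0%N by case: c tauE {nE} => //; lia.
  have tE : t = M by lia.
  rewrite c0 tE subnn /= mul1r cats0; rewrite c0 addn0 in nE; rewrite tE in red szp.
  by rewrite -nE in szp red sumD *; apply: (fg _ _ V) => //; lia.
move: le_tM; rewrite leq_eqVlt => /orP[/eqP tM|lt_tM].
  rewrite tM subnn addn0 in tauE szp red *.
  case: c nE tauE => // c nE tauE.
  rewrite iterS {1}/bdm_pullback step_column big_seq1 mul1r.
  rewrite mulSnr; have := IH c N.+1 0%N p (fun j => D j + (j != ord0))%N V.
  rewrite !subn0 !addn0; apply => //.
  - by lia.
  - by lia.
  - by lia.
  - by apply: reduced_scale red _ => j i; apply: mulmx_latmxS; lia.
  - rewrite big_split /= sumD mulSn addnC; congr (_ + _)%N.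
    by rewrite big_ord_recl /= sum1_card card_ord.
(* [N = 0] would force [t = M]. *)
case: N => [|N] in nE szp red sumD *; first by lia.
have [mt mE] : exists m : nat, (M - t = m.+1)%N by exists (M - t).-1; lia.
pose m := inord t.+1 : 'I_M.+1.
have mtE : m = t.+1 :> nat by rewrite inordK.
have [x0 Hx0] := reduced_symbol mtE red.
rewrite iterS {1}/bdm_pullback step_symbol // -/m mE addnS /=.
pose v (D' : 'I_M.+1 -> nat) := iter tau (bdm_pullback #|F| M) g (bdm_state N.+1 t.+1 D').
have Hx x : wsum (c * M + mt) (fun s => f (p ++ x :: s)) =
   #|F|%:R ^+ (c * M + mt) * (if (x != x0) && (D ord0 < D m)%N then v (D \o tperm ord0 m) else v D).
  have [E uE redE] := Hx0 x (V *m latmx M N.+1 (rcons p x))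
    (fun j i => mulmx_latmx_rcons x V j i lt_tM (ltac:(lia) : size p = (N * M + t)%N)).
  rewrite (eq_wsum _ (g := fun s => f (rcons p x ++ s))) => [|s]; last by rewrite cat_rcons.
  have mtE' : mt = (M - t.+1)%N by lia.
  rewrite mulmxA in redE.
  rewrite mtE' (IH c N.+1 t.+1 _ _ _ nE lt_tM _ _ _ redE) /v; first by case: ifP.
  - by lia.
  - by rewrite size_rcons; lia.
  - by rewrite unitmx_mul uE.
  - case: ifP => // _; rewrite -sumD [RHS](reindex_inj (@perm_inj _ (tperm ord0 m))) //.
under eq_bigr => x _ do rewrite Hx.
rewrite -mulr_sumr sum_but_one exprSr -[RHS]mulrA; congr (_ * (_ * _)).
by case: ifP => _; rewrite ?big_cons big_nil ?mul1r ?addr0.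
Qed.

(** * Counting prefixes *)

Lemma mseq_of_bij (F : finFieldType) M n :
  bijective (fun p : (n * M).-tuple F => mseq_of M n p).
Proof.
apply: inj_card_bij => [p p' eq_p|]; last first.
  by rewrite card_tuple !card_ffun !card_ord -expnM mulnC.
apply: eq_from_tnth => i; rewrite !(tnth_nth 0).
have ltM : (i %% M < M)%N by rewrite ltn_mod; case: (M) i => // -[]; rewrite muln0.
have ltn : (i %/ M < n)%N by rewrite ltn_divLR ?ltn_ord // (leq_ltn_trans _ ltM).
have := congr1 (fun a : mseq F M n => a (Ordinal ltn) (Ordinal ltM)) eq_p.
by rewrite !ffunE /= -divn_eq.
Qed.

Lemma Ncount_wsum (F : finFieldType) M n d :
  (Ncount F M n d)%:R = wsum (n * M) (fun p : seq F => (lc_dev (mseq_of M n p) == d)%:R : rat).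
Proof.
have [h hK Kh] := mseq_of_bij F M n.
rewrite wsumE /Ncount -sum1_card natr_sum big_mkcond /=.
rewrite (reindex (fun p : (n * M).-tuple F => mseq_of M n p)); last first.
  by exists h => p _; [exact: hK | exact: Kh].
by apply: eq_bigr => p _; rewrite inE; case: eqP.
Qed.

(** The balance d + T + sum of the b_m = 0 is automatic: the D_j sum to n M, and (M+1) times the
    ceiling is n M + T. *)
Lemma in_S_bdm_state M n (D : 'I_M.+1 -> nat) d :
  (\sum_j D j)%N = (n * M)%N ->
  in_S M (Posz (n %% M.+1)%N) M.+1 d (bdm_state n M D) =
    ((D ord0)%:Z - (ceil_nM M n)%:Z == d).
Proof.
move=> sumD; have lt_r := ltn_pmod n (ltn0Sn M).
rewrite /in_S /bdm_state /in_Sbar size_mkseq !eqxx leqnn /= lez_nat -ltnS lt_r /=.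
suff -> : (D ord0)%:Z - (ceil_nM M n)%:Z + (n %% M.+1)%N%:Z +
  \sum_(x <- mkseq (fun i => (D (inord i.+1))%:Z - (ceil_nM M n)%:Z) M) x == 0 by [].
have -> : \sum_(x <- mkseq (fun i => (D (inord i.+1))%:Z - (ceil_nM M n)%:Z) M) x =
    (\sum_(i < M) D (lift ord0 i))%N%:Z - (ceil_nM M n)%:Z *+ M.
  have := big_mkord xpredT (fun i => (D (inord i.+1))%:Z - (ceil_nM M n)%:Z) (n := M).
  rewrite big_map /index_iota subn0 => ->.
  rewrite big_split /= sumr_const card_ord mulNrn (big_morph Posz PoszD (erefl _)); congr (_ - _).
  apply: eq_bigr => i _; congr (D _)%:Z.
  by apply/val_inj; rewrite /= inordK // ltnS.
rewrite big_ord_recl in sumD.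
have cE : (ceil_nM M n * M.+1 = n * M + n %% M.+1)%N.
  rewrite ceil_nME; have := divn_eq n M.+1; move: (n %/ _)%N (n %% _)%N => k r; nia.
rewrite -mulr_natr natz; move: sumD cE; nia.
Qed.

Unset Implicit Arguments.

Theorem mainTheorem13 (F : finFieldType) (M : nat) (hM : (1 <= M)%N)
    (n : nat) (d : int) :
  let q := #|F| in
  let T0 : int := Posz (n %% M.+1)%N in
  ((Ncount F M n d)%:R : rat) =
    (q%:R : rat) ^+ (M * n)%N *
     \sum_(s <- mu_support q M (M.+1 * n)%N | in_S M T0 M.+1 d s) mu q M (M.+1 * n)%N s.
Proof.
move=> q T0; rewrite sum_mu_support Ncount_wsum.
have s0E : s0 M = bdm_state 0 M (fun _ : 'I_M.+1 => 0%N).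
  rewrite /s0 /bdm_state ceil_nME div0n mod0n /= subrr; congr (_, _, _, _).
  by apply: (@eq_from_nth _ 0) => [|i]; rewrite ?size_nseq ?size_mkseq // => lt_i;
    rewrite nth_nseq lt_i nth_mkseq.
(* Before any column every A_m is 0 and x^0 is 1, so the basis is the identity. *)
have red0 : reduced M (fun=> 0%N) (1%:M *m latmx M 0 ([::] : seq F)).
  suff -> : 1%:M *m latmx M 0 ([::] : seq F) = 1%:M by exact: reduced_id.
  rewrite mul1mx; apply/matrixP => i j; rewrite !mxE expr0 mulr1.
  case: (eqVneq i ord0) => [->|_]; last by [].
  by rewrite /revpoly poly_def big_ord0 [ord0 == j]eq_sym; case: (j == ord0).
have := @wsum_bdm F M n (fun p => (lc_dev (mseq_of M n p) == d)%:R)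
  (fun s => (in_S M T0 M.+1 d s)%:R) _ (M.+1 * n)%N n 0%N M [::] _ 1%:M _ _ _ _ _ red0.
rewrite subnn !addn0 -s0E [(M * n)%N]mulnC; apply; rewrite ?unitmx1 ?big1 ?mul0n //.
- by move=> p D V szp uV red sumD; rewrite /T0 in_S_bdm_state // /lc_dev (lin_comp_reduced uV red).
- by rewrite mulnC.
Qed.
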